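(* Let $G$ be a connected graph of order $n$ with minimum degree $\delta\geq 3$. Let $q_{\max}(G)$ denote the maximum, over all vertices $u\in V(G)$, of the number of connected components of $G\setminus u$ (the graph obtained from $G$ by deleting $u$). Then $rx_3(G)\leq n-q_{\max}(G)(\delta-1)+3$.
   Context: All graphs are finite, simple and undirected. Edge colorings are arbitrary (adjacent edges may receive the same color). In an edge-colored graph $G$, a tree $T\subseteq G$ (a subgraph that is a tree) is a rainbow tree if no two edges of $T$ have the same color. For a connected graph $G$ of order $n\ge 3$, a $3$-rainbow coloring of $G$ is an edge coloring such that for every set $S$ of $3$ vertices of $G$ there is a rainbow tree $T$ in $G$ with $S\subseteq V(T)$. The $3$-rainbow index $rx_3(G)$ is the minimum number of colors in a $3$-rainbow coloring of $G$. *)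

(* Defs.v *)
From HB Require Import structures.
From mathcomp Require Import all_boot all_order all_algebra.
From mathcomp Require Import boolp.

Set Implicit Arguments.
Unset Strict Implicit.
Unset Printing Implicit Defensive.

Record sgraph := SGraph {
  svertex :> finType;
  adj : rel svertex;
  adj_sym : symmetric adj;
  adj_irrefl : irreflexive adj }.

Section Graph.
Variable G : sgraph.

Definition connected_graph := forall x y : G, connect (@adj G) x y.

Definition degree (x : G) := #|[pred y | adj x y]|.

(* Every degree is below #|G|, so the default value matters only for the empty
   graph, whose minimum degree is then 0. *)
Definition min_degree := \big[minn/#|G|]_(x : G) degree x.

Definition n_components := n_comp (@adj G) G.

Definition edges : {set {set G}} :=
  [set [set p.1; p.2] | p : G * G & adj p.1 p.2].

Definition edge_rel (F : {set {set G}}) : rel G :=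
  [rel x y | [set x; y] \in F].

Definition is_subgraph (V : {set G}) (F : {set {set G}}) :=
  F \subset edges /\ (forall f, f \in F -> f \subset V).

Definition acyclic (F : {set {set G}}) :=
  forall s : seq G, 2 < size s -> uniq s -> ~~ cycle (edge_rel F) s.

Definition is_tree (V : {set G}) (F : {set {set G}}) :=
  [/\ is_subgraph V F, V != set0,
      {in V &, forall x y, connect (edge_rel F) x y} & acyclic F].

(* A colouring is a total function on sets of vertices; only its values on
   edges are ever used. *)
Definition rainbow_tree k (c : {set G} -> 'I_k) V F :=
  is_tree V F /\ {in F &, injective c}.

Definition rainbow3_coloring k (c : {set G} -> 'I_k) :=
  forall S : {set G}, #|S| = 3 ->
    exists (V : {set G}) (F : {set {set G}}), rainbow_tree c V F /\ S \subset V.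

Definition rainbow3_colorable k :=
  exists c : {set G} -> 'I_k, rainbow3_coloring c.

Lemma edge_rel_sym F : symmetric (edge_rel F).
Proof. by move=> x y; rewrite /edge_rel /= setUC. Qed.

Lemma set2_inj (a b x y : G) : [set a; b] = [set x; y] ->
  (a = x /\ b = y) \/ (a = y /\ b = x).
Proof.
move=> E.
have ha : a \in [set x; y] by rewrite -E set21.
have hb : b \in [set x; y] by rewrite -E set22.
have hx : x \in [set a; b] by rewrite E set21.
have hy : y \in [set a; b] by rewrite E set22.
move: ha hb hx hy; rewrite !inE.
by do 4![case/orP=> /eqP ?]; subst; auto.
Qed.

Lemma edge_rel_edges x y : edge_rel edges x y = adj x y.
Proof.
apply/imsetP/idP => [[[a b] /=]|xy]; last by exists (x, y); rewrite ?inE.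
by rewrite inE /= => + /set2_inj[] -[-> ->] //; rewrite adj_sym.
Qed.

Lemma spanning_tree : connected_graph -> forall x0 : G,
  exists F : {set {set G}}, is_tree [set: G] F.
Proof.
move=> cG x0.
pose P (F : {set {set G}}) :=
  (F \subset edges) && [forall x, forall y, connect (edge_rel F) x y].
have PE : P edges.
  rewrite /P subxx; apply/forallP => x; apply/forallP => y.
  by rewrite (eq_connect edge_rel_edges).
have [F /minsetP [/andP[FE /forallP Fc] Fmin] _] := minset_exists PE.
exists F; split.
- by split=> // f _; apply: subsetT.
- by apply/set0Pn; exists x0; rewrite inE.
- by move=> x y _ _; move/forallP: (Fc x); apply.
move=> [|x [|y [|z r]]] // _ us; apply/negP => cyc.
have xyF : [set x; y] \in F by case/andP: cyc.
suff PF : P (F :\ [set x; y]).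
  by have := Fmin _ PF (subsetDl _ _); move/setP/(_ [set x; y]); rewrite !inE eqxx xyF.
rewrite /P (subset_trans (subsetDl _ _) FE) /=.
set F' := F :\ _.
have F'yx : connect (edge_rel F') y x.
  apply/connectP; exists (rcons (z :: r) x); last by rewrite last_rcons.
  move: cyc => /= /andP[_].
  have NE a b : a != b -> (a != x) || (b != y) -> (a != y) || (b != x) ->
     [set a; b] \in F -> [set a; b] \in F'.
    move=> ab h1 h2 abF; rewrite /F' in_setD1 abF andbT.
    apply/eqP => E.
    by case: (set2_inj E) => -[ea eb]; move: h1 h2; rewrite ea eb !eqxx.
  move: us; rewrite /= !inE !negb_or -!andbA.
  case/and5P => xy xz xr yz /and3P[yr zr _].
  move=> /andP[yzF]; have -> /= : edge_rel F' y z.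
    by apply: NE => //; rewrite (eq_sym _ x) ?xy ?xz ?orbT.
  have : all (fun a => (a != x) && (a != y)) (z :: r).
    rewrite /= eq_sym xz eq_sym yz /=; apply/allP => a ar.
    by apply/andP; split; apply: contraTneq ar => ->.
  elim: r z {zr yzF xr yr xz yz} => [|w r IH] z /=.
    rewrite !andbT => /andP[zx zy] zxF; apply: NE => //; rewrite ?zx ?zy //.
  case/and3P=> /andP[zx zy] hw hr /andP[zw pw].
  apply/andP; split; last by apply: IH => //=; rewrite hw.
  apply: NE => //; rewrite ?zx ?zy //.
  apply: contraTneq zw => ->; apply/negP => ww.
  by have := subsetP FE _ ww; rewrite -[_ \in _]/(edge_rel edges w w)
     edge_rel_edges adj_irrefl.
apply/forallP => a; apply/forallP => b.
have /forallP/(_ b) := Fc a; apply: connect_sub => {}a {}b ab.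
have [E|N] := eqVneq [set a; b] [set x; y]; last first.
  by apply: connect1; rewrite /edge_rel /= /F' in_setD1 N.
have F'xy : connect (edge_rel F') x y.
  by rewrite (sym_connect_sym (@edge_rel_sym F')).
by case: (set2_inj E) => -[-> ->].
Qed.

Lemma rainbow3_colorable_ex :
  connected_graph -> exists k, `[< rainbow3_colorable k >].
Proof.
move=> cG; exists #|{set G}|; apply/asboolP; exists enum_rank => S S3.
have /card_gt0P[x0 _] : 0 < #|S| by rewrite S3.
have [F tF] := spanning_tree cG x0.
exists [set: G], F; split; last exact: subsetT.
by split=> // f g _ _; apply: enum_rank_inj.
Qed.

Definition rx3 (cG : connected_graph) : nat :=
  ex_minn (rainbow3_colorable_ex cG).

Lemma del_sym (u : G) :
  symmetric (fun x y : {x : G | x != u} => adj (val x) (val y)).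
Proof. by move=> x y; apply: adj_sym. Qed.

Lemma del_irrefl (u : G) :
  irreflexive (fun x y : {x : G | x != u} => adj (val x) (val y)).
Proof. by move=> x; apply: adj_irrefl. Qed.

Definition del_vertex (u : G) : sgraph := SGraph (@del_sym u) (@del_irrefl u).

End Graph.

Definition q_max (G : sgraph) := \max_(u : G) n_components (del_vertex u).

(* Main.v *)
(* Let u maximise the number q of components of G - u. Starting from u, one
   neighbour w_r of u in each component and delta - 1 neighbours of each w_r,
   grow a connected set K by absorbing outside vertices, keeping exactly
   delta - 1 vertices of every component out of K, until nothing else is left.
   Then #|K| = n - q (delta - 1), and each x outside K has at least two
   neighbours in K, since at most delta - 2 of its neighbours are left out.

   A spanning tree of K gets pairwise distinct colours. Four more colours
   suffice for the remaining edges: edges inside the complement of K get colour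
   3, and the edges from x to K show the colours {0, 1, 2} if all neighbours of
   x are in K (there are at least three of them), and otherwise {0, 1} or {1, 2}
   according to whether x belongs to a maximal independent set of the complement
   of K. Three vertices outside K can then be joined to K by edges of distinct
   colours 0, 1, 2, unless all three show the same pair of colours; in that case
   one of them has a neighbour outside K showing the missing colour, and it is
   attached to K through that neighbour, using colour 3. *)

Require Import Defs.
From mathcomp Require Import all_boot all_order all_algebra.
From mathcomp Require Import boolp zify.

Set Implicit Arguments.
Unset Strict Implicit.
Unset Printing Implicit Defensive.

(** * Trees grown by attaching leaves *)

Section Trees.
Variable G : sgraph.
Implicit Types (x y u v w : G) (K V : {set G}) (F : {set {set G}}).

Lemma min_degree_le x : min_degree G <= degree x.
Proof.
rewrite /min_degree; elim: (index_enum G) (mem_index_enum x) => // y r IHr.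
rewrite inE big_cons geq_min => /predU1P[->|/IHr ->]; first by rewrite leqnn.
by rewrite orbT.
Qed.

Lemma leaving_edge K x y : connected_graph G -> x \in K -> y \notin K ->
  exists a b, [/\ a \in K, b \notin K & adj a b].
Proof.
move=> cG Kx; have /connectP[p] := cG x y.
elim: p x Kx => [|z p IHp] x Kx /=; first by move=> _ ->; rewrite Kx.
case/andP=> xz pz yE; have [Kz|Kz] := boolP (z \in K); first exact: IHp pz yE.
by exists x, z.
Qed.

Lemma tree1 u : is_tree [set u] set0.
Proof.
split.
- by split=> [|f]; rewrite ?sub0set ?inE.
- by apply/set0Pn; exists u; rewrite inE.
- by move=> x y /set1P-> /set1P->.
by move=> [|x [|y s]] //= _ _; rewrite /edge_rel /= inE.
Qed.

(** A cycle through [v] would use two different neighbours of [v], whose only neighbour is [w]; a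
    cycle avoiding [v] lies in [F]. *)
Lemma acyclic_leaf V F v w : is_subgraph V F -> v \notin V -> acyclic F ->
  acyclic ([set w; v] |: F).
Proof.
move=> [_ FV] Vv acF s s2 us; apply/negP => cs.
have Fv x : edge_rel F v x = false.
  by apply: contraNF Vv => /FV/subsetP; apply; rewrite set21.
have [vs|vs] := boolP (v \in s).
  have [i s' E] := rot_to vs.
  have := cs; rewrite -(rot_cycle i) E.
  have := us; rewrite -(rot_uniq i) E.
  have := s2; rewrite -(size_rot i) E.
  case: s' {E} => [|a s'] //; case/lastP: s' => [|s' b] // _.
  rewrite /= rcons_path last_rcons.
  have vE x : v != x -> edge_rel ([set w; v] |: F) v x -> x = w.
    move=> vx; rewrite /edge_rel /= in_setU1 => /orP[/eqP/set2_inj|].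
      by case=> -[? ?] //; subst; rewrite eqxx in vx.
    by rewrite -[_ \in _]/(edge_rel F v x) Fv.
  rewrite !inE !mem_rcons !inE !negb_or -!andbA => /and5P[va vb _ ab _].
  case/and3P=> /(vE _ va) aw _ bv.
  have bw : b = w by apply: vE => //; rewrite edge_rel_sym.
  by rewrite aw bw eqxx in ab.
have := acF s s2 us.
rewrite (@eq_in_cycle _ (mem s) _ (edge_rel ([set w; v] |: F))).
- by rewrite cs.
- move=> x y xs ys; rewrite /edge_rel /= in_setU1 orb_idl // => /eqP E.
  have : v \in [set x; y] by rewrite E set22.
  by case/set2P=> E'; rewrite E' ?(xs : x \in s) ?(ys : y \in s) in vs.
exact/allP.
Qed.

Lemma tree_leaf V F v w : is_tree V F -> w \in V -> v \notin V -> adj w v ->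
  is_tree (v |: V) ([set w; v] |: F).
Proof.
move=> [sVF V0 cVF acF] Vw Vv wv; have [FE FV] := sVF; split.
- split.
    rewrite subUset FE andbT sub1set; apply/imsetP.
    by exists (w, v); rewrite ?inE.
  move=> f /setU1P[->|/FV fV]; last by rewrite (subset_trans fV) ?subsetU1.
  by rewrite subUset !sub1set !inE Vw eqxx orbT.
- by apply/set0Pn; exists v; rewrite setU11.
- have sub x y : connect (edge_rel F) x y ->
      connect (edge_rel ([set w; v] |: F)) x y.
    apply: connect_sub => a b ab; apply: connect1.
    by rewrite /edge_rel /= setU1r.
  have csym := sym_connect_sym (@edge_rel_sym G ([set w; v] |: F)).
  have cw x : x \in v |: V -> connect (edge_rel ([set w; v] |: F)) w x.
    case/setU1P => [->|Vx]; last exact/sub/cVF.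
    by apply: connect1; rewrite /edge_rel /= setU11.
  by move=> x y /cw + /cw; rewrite csym; apply: connect_trans.
exact: acyclic_leaf sVF Vv acF.
Qed.

(* For a tree the bound is #|F| = #|V| - 1; only this inequality is needed, to
   count colours. *)
Definition small_tree V F := is_tree V F /\ #|F| < #|V|.

Lemma small_tree_leaf V F v w : small_tree V F -> w \in V -> v \notin V ->
  adj w v -> small_tree (v |: V) ([set w; v] |: F).
Proof.
move=> [tVF FV] Vw Vv wv; split; first exact: tree_leaf.
rewrite cardsU1 Vv add1n ltnS; apply: leq_trans FV.
by rewrite cardsU1; case: (_ \notin _).
Qed.

Lemma small_tree_star u (A : {set G}) : A \subset [pred x | adj u x] ->
  exists F, small_tree (u |: A) F.
Proof.
have [n] := ubnP #|A|; elim: n A => // n IHn A An /subsetP Au.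
have [->|/set0Pn[a aA]] := eqVneq A set0.
  by exists set0; rewrite setU0; split; [exact: tree1|rewrite cards0 cards1].
have [||F tF] := IHn (A :\ a).
- by move: An; rewrite (cardsD1 a A) aA ltnS.
- by apply/subsetP=> x /setD1P[_ /Au].
have ua : adj u a := Au _ aA.
exists ([set u; a] |: F); rewrite -(setD1K aA) setUCA.
apply: small_tree_leaf => //.
  exact: setU11.
by rewrite !inE eqxx orbF; apply: contraTneq ua => ->; rewrite adj_irrefl.
Qed.

End Trees.

(** * Growth of a connected set around [u] *)

Section Growth.
Variables (G : sgraph) (u : G) (T : finType) (kappa : G -> T) (R : {set T}).
Hypothesis cG : connected_graph G.
Hypothesis kappa_adj : forall x y, x != u -> y != u -> adj x y ->
  kappa x = kappa y.
Hypothesis kappaR : forall x, x != u -> kappa x \in R.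

(** [kappa] stands for the component of a vertex in [G - u], and [R] for the set of components. *)
Definition balanced m (L : {set G}) :=
  forall r, r \in R -> \sum_(x in L) (kappa x == r) = m.

Definition growing m (K L : {set G}) F :=
  [/\ small_tree K F, u \in K, {in L, forall l, l \notin K},
      (forall l, l \in L -> exists2 k, k \in K & adj k l) & balanced m L].

(* When K and L do not cover G, some edge leaves their union. If it starts in K,
   its far end joins K; if it starts at a in L, then a joins K and the far end,
   which lies in the same component, replaces a in L. *)
Lemma growing_full m K L F : growing m K L F ->
  exists K' F', growing m K' (~: K') F'.
Proof.
have [n] := ubnP #|~: K|; elim: n K L F => // n IHn K L F Kn.
have Kn' v : v \notin K -> #|~: (v |: K)| < n.
  move: Kn; rewrite setCU setIC -setDE ltnS (cardsD1 v) inE => + vK.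
  by rewrite vK.
move=> gKL; have [tK uK dKL adjL bL] := gKL.
have [KL|] := eqVneq (K :|: L) setT.
  exists K, F; suff <- : L = ~: K by [].
  apply/setP=> x; have := in_setT x; rewrite -KL !inE.
  case/orP=> [xK|xL]; last by rewrite xL dKL.
  by rewrite xK; apply: contraTF xK => /dKL.
rewrite -subTset => /subsetPn[y _ yKL].
have uKL : u \in K :|: L by rewrite inE uK.
have [a [b [aKL]]] := leaving_edge cG uKL yKL.
rewrite inE negb_or => /andP[bK bL'] ab.
have [aK|aK] := boolP (a \in K).
  apply: (IHn (b |: K) L ([set a; b] |: F)); first exact: Kn'.
  split=> //.
  - exact: small_tree_leaf.
  - by rewrite setU1r.
  - move=> l lL; rewrite !inE negb_or dKL // andbT.
    by apply: contraTneq lL => ->.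
  - by move=> l /adjL[k kK kl]; exists k; rewrite // setU1r.
have aL : a \in L by move: aKL; rewrite inE (negPf aK).
have [k kK ka] := adjL a aL.
apply: (IHn (a |: K) (b |: L :\ a) ([set k; a] |: F)); first exact: Kn'.
have anb : a != b by apply: contraTneq aL => ->.
split.
- exact: small_tree_leaf.
- by rewrite setU1r.
- move=> l; rewrite !inE negb_or => /predU1P[->|/andP[-> /dKL //]].
  by rewrite eq_sym anb.
- move=> l /setU1P[->|/setD1P[_ /adjL[k' k'K k'l]]].
    by exists a; rewrite // setU11.
  by exists k'; rewrite // setU1r.
- move=> r rR; rewrite -(bL r rR) (big_setD1 a aL) big_setU1 /=; last first.
    by rewrite !inE (negPf bL') andbF.
  congr (_ + _); rewrite (@kappa_adj a b) //.
    by apply: contraNneq aK => ->.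
  by apply: contraNneq bK => ->.
Qed.

Lemma growing_start m : (forall x : G, m < degree x) ->
  (forall r, r \in R -> exists2 w, adj u w & kappa w = r) ->
  exists K L F, growing m K L F.
Proof.
move=> mdeg root_ex.
have /choice[w wP] r : exists w, r \in R -> adj u w /\ kappa w = r.
  have [/root_ex[w uw kw]|_] := boolP (r \in R); first by exists w.
  by exists u.
have wu r : r \in R -> w r != u.
  by case/wP=> uw _; apply: contraTneq uw => ->; rewrite adj_irrefl.
pose N r := [set x | (x != u) && adj (w r) x].
(* Dropping [u] costs [w r] at most one neighbour, so at least [m] remain. *)
have /choice[A AP] r : exists A : {set G}, A \subset N r /\ #|A| = m.
  have : 0 < 'C(#|N r|, m).
    rewrite bin_gt0 -ltnS; apply: leq_trans (mdeg (w r)) _.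
    rewrite [degree _](cardD1 u) -[X in _ <= X]add1n leq_add ?leq_b1 //.
    by apply/subset_leq_card/subsetP=> x; rewrite !inE.
  rewrite -cards_draws => /card_gt0P[A]; rewrite inE => /andP[sA /eqP cA].
  by exists A.
have kA r x : r \in R -> x \in A r -> kappa x = r.
  move=> rR xA; have [/subsetP/(_ x xA)] := AP r; rewrite inE => /andP[xu wx] _.
  by have [_ <-] := wP r rR; rewrite (kappa_adj (wu r rR) xu wx).
pose L := [set x | (kappa x \in R) && (x \in A (kappa x))].
have [|F tF] := @small_tree_star G u [set w r | r in R].
  by apply/subsetP=> _ /imsetP[r /wP[uw _] ->].
have adjL x : x \in L -> adj (w (kappa x)) x /\ x != u.
  rewrite inE => /andP[_ xA].
  have [/subsetP/(_ x xA)] := AP (kappa x).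
  by rewrite inE => /andP[].
exists (u |: [set w r | r in R]), L, F; split=> //.
- exact: setU11.
(* If [x] were [w r], its label would be [r], making [x] adjacent to itself. *)
- move=> x Lx; have [xw xu] := adjL x Lx.
  rewrite !inE negb_or xu; apply/negP => /imsetP[r rR xE].
  by move: xw; rewrite xE; have [_ ->] := wP r rR; rewrite adj_irrefl.
- move=> l Ll; exists (w (kappa l)); last by case: (adjL l Ll).
  by rewrite setU1r //; apply: imset_f; move: Ll; rewrite inE => /andP[].
move=> r rR; have [_ <-] := AP r.
rewrite -sum1_card -big_mkcondr /=; apply: eq_bigl => x; rewrite inE.
apply/andP/idP => [[/andP[_ +] /eqP <-] //|xA].
by rewrite (kA r x) // rR xA.
Qed.

(** Double counting: a vertex outside [K] is not [u], so it carries exactly one label of [R]. *)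
Lemma balanced_card m (K : {set G}) : u \in K -> balanced m (~: K) ->
  #|K| + #|R| * m = #|G|.
Proof.
move=> uK bK; rewrite -(cardsC K); congr (_ + _).
rewrite -sum_nat_const -(eq_bigr _ bK) exchange_big -sum1_card /=.
apply: eq_bigr => x; rewrite inE => xK.
have xR : kappa x \in R by apply: kappaR; apply: contraNneq xK => ->.
rewrite (bigD1 (kappa x)) //= eqxx big1 // => r /andP[_ /negPf].
by rewrite eq_sym => ->.
Qed.

(** Neighbours of [x] outside [K] share its label, and only [m - 1] other vertices outside [K] do
    so; a degree above [m] leaves two neighbours in [K]. *)
Lemma balanced_dominating m (K : {set G}) x : u \in K -> balanced m (~: K) ->
  x \notin K -> m < degree x -> 1 < #|[set y in K | adj x y]|.
Proof.
move=> uK bK xK; set N := [set y in K | _].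
have nu y : y \notin K -> y != u by apply: contraNneq => ->.
have xC : x \in ~: K by rewrite inE.
have := bK (kappa x) (kappaR (nu x xK)).
rewrite (bigD1 x) //= eqxx => <-; rewrite add1n.
have -> : degree x = #|N| + #|[set y in ~: K | adj x y]|.
  rewrite -[degree x](cardID (mem K)); congr (_ + _); apply: eq_card => y;
  by rewrite !inE // andbC.
suff le : #|[set y in ~: K | adj x y]| <=
    \sum_(y in ~: K | y != x) (kappa y == kappa x).
  move=> lt; rewrite -(ltn_add2r #|[set y in ~: K | adj x y]|).
  by rewrite (leq_trans _ lt) // !ltnS.
rewrite -sum1_card -[X in _ <= X]big_mkcondr /=.
rewrite [X in _ <= X](bigID (adj x)) /=.
apply: leq_trans (leq_addr _ _); apply/eq_leq/eq_bigl => y; rewrite !inE.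
have [yK|//] := boolP (y \notin K).
have [xy|_] := boolP (adj x y); last by rewrite !andbF.
rewrite (kappa_adj (nu _ xK) (nu _ yK) xy) eqxx !andbT; symmetry.
by apply: contraTneq xy => ->; rewrite adj_irrefl.
Qed.

End Growth.

Lemma dominating_tree (G : sgraph) (u : G) d : connected_graph G ->
  0 < d -> (forall x : G, d <= degree x) ->
  exists (K : {set G}) F, [/\ small_tree K F,
    #|K| + n_components (del_vertex u) * (d - 1) = #|G| &
    forall x, x \notin K -> 1 < #|[set y in K | adj x y]|].
Proof.
move=> cG d0 dG; set H := del_vertex u.
have csym := sym_connect_sym (@adj_sym H).
(* Labels are the chosen roots of the components, with [None] for [u]. *)
pose kappa x : option H := omap (fingraph.root (@adj H)) (insub x).
pose R := [set Some r | r : H & fingraph.roots (@adj H) r].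
have kE (h : H) : kappa (val h) = Some (fingraph.root (@adj H) h).
  by rewrite /kappa valK.
have nuE x : x != u -> exists h : H, val h = x.
  by move=> xu; exists (Sub x xu); rewrite SubK.
have k_adj x y : x != u -> y != u -> adj x y -> kappa x = kappa y.
  move=> /nuE[h <-] /nuE[h' <-] hh'; rewrite !kE; congr Some.
  by apply/(fingraph.rootP csym); apply: connect1.
have kR x : x != u -> kappa x \in R.
  move=> /nuE[h <-]; rewrite kE; apply/imsetP.
  exists (fingraph.root (@adj H) h) => //.
  by rewrite inE roots_root.
have rootR r : r \in R -> exists2 w, adj u w & kappa w = r.
  case/imsetP=> h; rewrite inE => /eqP hr ->.
  (* By connectivity an edge leaves the component of [h]; its outer end must be [u], or both ends
     would share a label. *)
  have [|| a [b []]] :=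
    @leaving_edge G [set x | kappa x == Some h] (val h) u cG.
  - by rewrite inE kE hr.
  - by rewrite inE /kappa insubF ?eqxx.
  rewrite !inE => /eqP ka kb ab; exists a => //; rewrite adj_sym.
  have [<- //|bu] := eqVneq b u.
  have au : a != u.
    by apply: contra_eq_neq ka => ->; rewrite /kappa insubF ?eqxx.
  by rewrite -(k_adj a b au bu ab) ka eqxx in kb.
have dm (x : G) : d - 1 < degree x by rewrite subn1 prednK ?dG.
have [K0 [L [F0 gr0]]] := growing_start k_adj dm rootR.
have [K [F [tK uK _ _ bK]]] := growing_full cG k_adj gr0.
exists K, F; split=> //.
  rewrite -(balanced_card kR uK bK) card_imset; last by move=> ? ? [].
  rewrite cardsE /n_components /n_comp_mem; congr (_ + _ * _).
  by apply: eq_card => x; rewrite !inE andbT.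
move=> x xK; exact: (balanced_dominating k_adj kR uK bK xK (dm x)).
Qed.

(** Take [I] maximal independent outside [K]: neighbours of a member are not members, and by
    maximality a non-member has a neighbour in [I]. *)
Lemma alternating_set (G : sgraph) (K : {set G}) : exists I : {set G},
  forall x y, x \notin K -> y \notin K -> adj x y ->
  exists w, [/\ w \notin K, adj x w & (w \in I) = (x \notin I)].
Proof.
pose P (I : {set G}) := [&& I \subset ~: K &
  [forall x in I, forall y in I, ~~ adj x y]].
have [|I /maxsetP[/andP[IK /forall_inP indI] Imax] _] :=
  @maxset_exists G P set0.
  by rewrite /P sub0set; apply/forall_inP=> x; rewrite inE.
exists I => x y xK yK xy; have [xI|xI] := boolP (x \in I).
  exists y; split=> //; apply/negbTE/negP => yI.
  by move/forall_inP: (indI x xI) => /(_ y yI); rewrite xy.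
suff /exists_inP[w wI xw] : [exists w in I, adj x w].
  by exists w; split=> //; move/subsetP: IK => /(_ w wI); rewrite inE.
apply: contraNT xI => /exists_inPn nadj.
rewrite -(Imax (x |: I)) ?setU11 ?subsetU1 //.
rewrite /P subUset sub1set inE xK IK; apply/forall_inP => a /setU1P[->|aI];
  apply/forall_inP => b /setU1P[->|bI]; rewrite ?adj_irrefl ?nadj //.
  by rewrite adj_sym nadj.
by move/forall_inP: (indI a aI) => /(_ b bI).
Qed.

(** * The edge colouring and its rainbow trees *)

Section Coloring.
Variables (G : sgraph) (K I : {set G}) (F : {set {set G}}).
Hypothesis tKF : small_tree K F.
Hypothesis domK : forall x, x \notin K -> 1 < #|[set y in K | adj x y]|.
Hypothesis deg3 : forall x : G, 2 < degree x.
Hypothesis altI : forall x y, x \notin K -> y \notin K -> adj x y ->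
  exists w, [/\ w \notin K, adj x w & (w \in I) = (x \notin I)].

(* The second disjunct is the one that matters: outside K, x is isolated in the
   complement of K. *)
Definition sheltered x := (x \in K) || [forall y, adj x y ==> (y \in K)].

(* Colour 1, the default value of nth in foot_color, is omitted: it is shown by
   every x outside K. *)
Definition outer_colors x :=
  if sheltered x then [:: 0; 2] else if x \in I then [:: 0] else [:: 2].

(** In enumeration order, the first neighbours of [x] in [K] get the listed colours, one each, and
    all later ones get 1. *)
Definition foot_color x d :=
  nth 1 (outer_colors x) (index d (enum [set y in K | adj x y])).

(** Numbers from 4 on are reserved for [F]; the default 3 falls to the other edges that do not join
    [K] to its complement. *)
Definition col (e : {set G}) :=
  if e \in F then 4 + index e (enum F) else
  match [pick x in e :\: K], [pick d in e :&: K] with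
  | Some x, Some d => foot_color x d
  | _, _ => 3
  end.

Let FK f : f \in F -> f \subset K.
Proof. by case: tKF => -[[_ FK] _ _ _] _; apply: FK. Qed.

Lemma foot_color_lt x d : foot_color x d < 3.
Proof.
rewrite /foot_color /outer_colors; case: (index _ _) => [|[|[|i]]] /=;
  by case: ifP => _ //; case: ifP.
Qed.

Lemma col_foot x d : x \notin K -> d \in K -> col [set d; x] = foot_color x d.
Proof.
move=> xK dK; rewrite /col ifN; last first.
  by apply: contra xK => /FK/subsetP; apply; rewrite set22.
case: pickP => [x'|/(_ x)]; last by rewrite !inE eqxx orbT xK.
rewrite !inE => /andP[x'K /pred2P[x'E|->]]; first by rewrite x'E dK in x'K.
case: pickP => [d'|/(_ d)]; last by rewrite !inE eqxx dK.
by rewrite !inE => /andP[/pred2P[->//|d'E]]; rewrite d'E (negPf xK).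
Qed.

Lemma col_out x y : x \notin K -> y \notin K -> col [set y; x] = 3.
Proof.
move=> xK yK; rewrite /col ifN; last first.
  by apply: contra xK => /FK/subsetP; apply; rewrite set22.
case: pickP => // a _; case: pickP => // b; rewrite !inE.
by case/andP=> /pred2P[] ->; rewrite ?(negPf xK) ?(negPf yK).
Qed.

(** A tree on [K] has fewer than [#|K|] edges, so [4 + #|F|] is at most [#|K| + 3]. *)
Lemma col_lt e : col e < #|K| + 3.
Proof.
have FKlt : #|F| < #|K| by case: tKF.
have K0 : 0 < #|K| by apply: leq_ltn_trans FKlt.
rewrite /col; case: ifP => [eF|_].
  rewrite (addnC 4) (addnA _ 1 3) ltn_add2r addn1 (leq_trans _ FKlt) // ltnS.
  by rewrite cardE index_mem mem_enum.
have lt3 : 3 < #|K| + 3 by rewrite -add1n leq_add.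
case: pickP => [x _|//]; case: pickP => [d _|//].
exact: ltn_trans (foot_color_lt _ _) lt3.
Qed.

Definition reachable_by (V : {set G}) a x :=
  x \in V \/ exists2 w, w \in V & adj w x /\ col [set w; x] = a.

(** Outside [K], [x] has more neighbours in [K] than listed colours (three if sheltered, two by
    domination otherwise), so the default 1 occurs too. *)
Lemma reachable_outer x a : a \in rcons (outer_colors x) 1 ->
  reachable_by K a x.
Proof.
move=> aC; have [xK|xK] := boolP (x \in K); [by left|right].
set E := enum [set y in K | adj x y].
have lt_size : size (outer_colors x) < size E.
  rewrite /outer_colors -cardE; have [sx|_] := boolP (sheltered x).
    rewrite (leq_trans (deg3 x)) //; apply/subset_leq_card/subsetP => y.
    move: sx; rewrite /sheltered (negPf xK) => /forallP/(_ y).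
    by rewrite !inE => /implyP Ky xy; rewrite Ky.
  by case: ifP => _; apply: domK.
pose i := index a (rcons (outer_colors x) 1).
have i_lt : i < size E.
  by rewrite (leq_trans _ lt_size) // -(size_rcons _ 1) index_mem.
have := mem_nth x i_lt; rewrite mem_enum inE => /andP[dK xd].
exists (nth x E i) => //; rewrite adj_sym; split=> //.
rewrite col_foot // /foot_color index_uniq ?enum_uniq //.
by rewrite -[RHS](nth_index 1 aC) nth_rcons_default.
Qed.

(** [U] records the colours below 4 already spent; those of [F] start at 4, so a new edge coloured
    below 4 need only avoid [U]. *)
Definition rainbow_extension (V : {set G}) (F' : {set {set G}}) (U : seq nat) :=
  [/\ is_tree V F', {in F' &, injective col}, K \subset V &
      {in F', forall f, col f < 4 -> col f \in U}].

Lemma rainbow_extension0 : rainbow_extension K F [::].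
Proof.
case: tKF => tF _; split=> //; last by move=> f fF; rewrite /col fF.
move=> f g fF gF; rewrite /col fF gF => /addnI E.
by apply: (@index_inj _ f (enum F)); rewrite ?mem_enum.
Qed.

Lemma rainbow_attach V F' U a x : rainbow_extension V F' U ->
  reachable_by V a x -> a < 4 -> a \notin U ->
  exists V' F'',
    [/\ rainbow_extension V' F'' (a :: U), V \subset V' & x \in V'].
Proof.
move=> [tV injF KV colU] rx a4 aU; have [xV|xV] := boolP (x \in V).
  exists V, F'; split=> //; split=> // f fF f4.
  by rewrite inE colU ?orbT.
case: rx => [|[w wV [wx colwx]]]; first by rewrite (negPf xV).
have new f : f \in F' -> col f != a.
  by move=> fF; apply: contraNneq aU => fa; rewrite -fa colU // fa.
exists (x |: V), ([set w; x] |: F'); split; rewrite ?setU11 ?subsetU1 //.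
split.
- exact: tree_leaf.
- move=> f g /setU1P[->|fF] /setU1P[->|gF] //; last exact: injF.
  + by rewrite colwx => /esym/eqP; rewrite (negPf (new g gF)).
  + by rewrite colwx => /eqP; rewrite (negPf (new f fF)).
- by rewrite (subset_trans KV) ?subsetU1.
move=> f /setU1P[->|fF] f4; first by rewrite colwx mem_head.
by rewrite inE colU ?orbT.
Qed.

Definition rainbow_joinable x y z :=
  exists V F', [/\ is_tree V F', {in F' &, injective col} &
                   [/\ x \in V, y \in V & z \in V]].

Lemma reachable_sub (V V' : {set G}) a x :
  V \subset V' -> reachable_by V a x -> reachable_by V' a x.
Proof.
move=> /subsetP VV' [/VV' xV|[w /VV' wV xw]]; [by left|by right; exists w].
Qed.

Lemma joinable_feet a b c x y z : reachable_by K a x -> reachable_by K b y ->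
  reachable_by K c z -> all (gtn 4) [:: a; b; c] -> uniq [:: c; b; a] ->
  rainbow_joinable x y z.
Proof.
move=> rx ry rz /and4P[a4 b4 c4 _] /and3P[cU bU _].
have [V1 [F1 [r1 K1 x1]]] := rainbow_attach rainbow_extension0 rx a4 isT.
have [V2 [F2 [r2 V12 y2]]] := rainbow_attach r1 (reachable_sub K1 ry) b4 bU.
have rz' := reachable_sub (subset_trans K1 V12) rz.
have [V3 [F3 [[t3 i3 _ _] /subsetP V23 z3]]] := rainbow_attach r2 rz' c4 cU.
exists V3, F3; split=> //; split=> //; apply: V23 => //.
exact: (subsetP V12).
Qed.

(** First [w] is attached, then [x] through [w] by an edge outside [K], of colour 3; hence the bound
    3 on the other colours. *)
Lemma joinable_detour a b c w x y z : reachable_by K a w ->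
  w \notin K -> x \notin K -> adj w x ->
  reachable_by K b y -> reachable_by K c z ->
  all (gtn 3) [:: a; b; c] -> uniq [:: c; b; a] -> rainbow_joinable x y z.
Proof.
move=> rw wK xK wx ry rz /and4P[a3 b3 c3 _].
rewrite /= !inE !negb_or => /and3P[/andP[cb ca] ba _].
have [V1 [F1 [r1 K1 w1]]] := rainbow_attach rainbow_extension0 rw (ltnW a3) isT.
have rx : reachable_by V1 3 x by right; exists w; rewrite ?col_out.
have a3' : 3 \notin [:: a] by rewrite inE eq_sym (ltn_eqF a3).
have [V2 [F2 [r2 V12 x2]]] := rainbow_attach r1 rx isT a3'.
have K2 := subset_trans K1 V12.
have bU : b \notin [:: 3; a] by rewrite !inE (ltn_eqF b3) (negPf ba).
have [V3 [F3 [r3 V23 y3]]] :=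
  rainbow_attach r2 (reachable_sub K2 ry) (ltnW b3) bU.
have K3 := subset_trans K2 V23.
have cU : c \notin [:: b; 3; a].
  by rewrite !inE (negPf cb) (ltn_eqF c3) (negPf ca).
have [V4 [F4 [[t4 i4 _ _] /subsetP V34 z4]]] :=
  rainbow_attach r3 (reachable_sub K3 rz) (ltnW c3) cU.
exists V4, F4; split=> //; split=> //; apply: V34 => //.
exact: (subsetP V23).
Qed.

(** Colour 1 serves [z]. A sheltered [x] offers both 0 and 2 and takes the one that [y] leaves.
    Otherwise, should [x] and [y] lie on the same side of [I], a neighbour [w] of [x] on the other
    side can supply the missing colour. *)
Lemma joinable_all x y z : rainbow_joinable x y z.
Proof.
have r1 v : reachable_by K 1 v.
  by apply: reachable_outer; rewrite mem_rcons mem_head.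
have r0 v : sheltered v || (v \in I) -> reachable_by K 0 v.
  move=> h; apply: reachable_outer; move: h.
  by rewrite /outer_colors; case: (sheltered v) => //= ->.
have r2 v : sheltered v || (v \notin I) -> reachable_by K 2 v.
  move=> h; apply: reachable_outer; move: h.
  by rewrite /outer_colors; case: (sheltered v) => //= /negPf ->.
have [xh|] := boolP (sheltered x).
  have [yI|yI] := boolP (y \in I).
    by apply: (@joinable_feet 2 0 1) => //;
       [apply: r2; rewrite xh|apply: r0; rewrite yI orbT].
  by apply: (@joinable_feet 0 2 1) => //;
     [apply: r0; rewrite xh|apply: r2; rewrite yI orbT].
rewrite negb_or negb_forall => /andP[xK /existsP[y0]].
rewrite negb_imply => /andP[xy0 y0K].
have [w [wK xw wI]] := altI xK y0K xy0.
have wx : adj w x by rewrite adj_sym.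
have [xI|xI] := boolP (x \in I); rewrite ?xI ?(negPf xI) /= in wI.
- have x0 : reachable_by K 0 x by apply: r0; rewrite xI orbT.
  have [y2|/norP[_ /negPn yI]] := boolP (sheltered y || (y \notin I)).
    by apply: (@joinable_feet 0 2 1) => //; apply: r2.
  have y0' : reachable_by K 0 y by apply: r0; rewrite yI orbT.
  have w2 : reachable_by K 2 w by apply: r2; rewrite wI orbT.
  exact: (@joinable_detour 2 0 1 w).
- have x2 : reachable_by K 2 x by apply: r2; rewrite xI orbT.
  have [yI|yI] := boolP (y \in I).
    by apply: (@joinable_feet 2 0 1) => //; apply: r0; rewrite yI orbT.
  have y2 : reachable_by K 2 y by apply: r2; rewrite yI orbT.
  have w0 : reachable_by K 0 w by apply: r0; rewrite wI orbT.
  exact: (@joinable_detour 0 2 1 w).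
Qed.

Lemma col_rainbow3 : rainbow3_colorable G (#|K| + 3).
Proof.
rewrite addnS; exists (fun e => inord (col e)) => S.
rewrite cardE; case ES: (enum S) => [|x [|y [|z []]]] // _.
have [V [F' [tV inj [xV yV zV]]]] := joinable_all x y z.
exists V, F'; split; last first.
  by apply/subsetP=> v; rewrite -mem_enum ES !inE => /or3P[] /eqP->.
split=> // f g fF gF /(congr1 val) /=.
by rewrite !inordK -?addnS ?col_lt //; apply: inj.
Qed.

End Coloring.

Theorem theorem4p3 (G : sgraph) (cG : connected_graph G)
    (delta_ge3 : 3 <= min_degree G) :
  ((rx3 cG)%:Z <=
     #|G|%:Z - (q_max G)%:Z * ((min_degree G)%:Z - 1) + 3)%R.
Proof.
have deg_ge := @min_degree_le G.
(* The minimum degree never exceeds its default value [#|G|], so [G] is non-empty and the maximum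
   over [u] is attained. *)
have G0 : 0 < #|G|.
  apply: leq_trans (ltnW (ltnW delta_ge3)) _; rewrite /min_degree.
  by elim/big_rec: _ => // x d _; rewrite geq_min => ->; rewrite orbT.
have [u qE] := eq_bigmax (fun u => n_components (del_vertex u)) G0.
have [K [F [tK cardK domK]]] :=
  dominating_tree u cG (ltnW (ltnW delta_ge3)) deg_ge.
have [I altI] := alternating_set K.
have := col_rainbow3 tK domK (fun x => leq_trans delta_ge3 (deg_ge x)) altI.
rewrite /q_max qE /rx3; case: ex_minnP => k _ kmin /asboolP/kmin.
move: cardK delta_ge3; lia.
Qed.
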